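(* Let $q$ be a prime power, $m\ge1$, and let $\mathcal E$ be an egg in ${\rm PG}(4m-1,q)$ with a fixed element $E_\infty$ and tangent space $E_\infty^*$ at $E_\infty$. Let $\Gamma'$ be a $3m$-dimensional subspace of ${\rm PG}(4m-1,q)$ containing $E_\infty^*$. Put $\mathcal B_{\mathcal E}=\{E\cap\Gamma': E\in\mathcal E, E\ne E_\infty\}$ (a set of points of $\Gamma'\setminus E^*_\infty$) and $\mathcal I_{\mathcal E}=\{E^*\cap E^*_\infty: E\in\mathcal E, E\ne E_\infty\}$, where $E^*$ is the tangent space at $E$. Let $\mathcal F_{\mathcal E}$ be the family of all $2m$-dimensional subspaces of $\Gamma'$ not contained in $E^*_\infty$ that contain an element of $\mathcal I_{\mathcal E}$, and assume that $\mathcal B_{\mathcal E}$ is a minimal $\mathcal F_{\mathcal E}$-blocking set. Embed $\Gamma'$ in ${\rm PG}(4m,q)$ as a $3m$-dimensional subspace meeting a hyperplane $\Sigma_\infty$ of ${\rm PG}(4m,q)$ exactly in (the image of) $E^*_\infty$. Suppose there exist a $(2m-1)$-spread $\mathcal S$ of $\Sigma_\infty$, an element $\mathbf z\in\mathcal S$ and an $(m-1)$-dimensional subspace $\mathcal V\subseteq\mathbf z$ disjoint from $E^*_\infty$ such that $\mathcal I_{\mathcal E}=\mathcal I(\mathcal V)$, where $\mathcal I(\mathcal V)=\{\langle\mathbf x,\mathcal V\rangle\cap E^*_\infty:\mathbf x\in\mathcal S\setminus\{\mathbf z\}\}$. Then the set $\mathcal B^*$ of points of $\Pi(\mathcal S)$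 consisting of all affine points of the subspaces $\langle P,\mathcal V\rangle$, $P\in\mathcal B_{\mathcal E}$, together with the point $\mathbf z$, is a unital in $\Pi(\mathcal S)$.
   Context: An egg in ${\rm PG}(4m-1,q)$ is a set $\mathcal E$ of $q^{2m}+1$ pairwise disjoint $(m-1)$-dimensional subspaces such that any three of them span a $(3m-1)$-dimensional subspace. For each $E\in\mathcal E$ there is a unique $(3m-1)$-dimensional subspace $E^*$ (the tangent space at $E$) containing $E$ and disjoint from all other elements of $\mathcal E$. A set $\mathcal B$ of points of $\Gamma'\setminus E^*_\infty$ is a minimal $\mathcal F_{\mathcal E}$-blocking set if it meets every element of $\mathcal F_{\mathcal E}$ and through every $P\in\mathcal B$ there is an element of $\mathcal F_{\mathcal E}$ meeting $\mathcal B$ only in $P$. A $(2m-1)$-spread is a set of $(2m-1)$-dimensional subspaces partitioning the points. $\Pi(\mathcal S)$ is the André/Bruck–Bose plane: points are the affine points of ${\rm PG}(4m,q)$ (not in $\Sigma_\infty$) and the elements of $\mathcal S$; lines are the $2m$-dimensional subspaces not contained in $\Sigma_\infty$ meeting $\Sigma_\infty$ in an element of $\mathcal S$, plus the line $\mathcal S$; incidence is containment; it has order $q^{2m}$. A unital in a projective plane of order $n^2$ is a set of $n^3+1$ points meeting every line in $1$ or $n+1$ points. *)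

(* Defs.v *)
(* PG(d, q) is the lattice of subspaces {vspace V} of a vector space V over
   F : finFieldType with q = #|F| and \dim {:V} = d.+1.  A projective subspace
   of projective dimension k is a vector subspace of \dim k.+1; in particular
   points are the subspaces of \dim 1, disjoint subspaces are those with
   intersection 0%VS, and the span <A, B> is (A + B)%VS. *)
From HB Require Import structures.
From mathcomp Require Import all_boot all_order all_algebra.

Set Implicit Arguments.
Unset Strict Implicit.
Unset Printing Implicit Defensive.

Import VectorInternalTheory.

HB.instance Definition _ (F : finFieldType) (V : vectType F) :=
  [Countable of {vspace V} by <:].
HB.instance Definition _ (F : finFieldType) (V : vectType F) :=
  [Finite of {vspace V} by <:].

Section Subspaces.
Variables (F : finFieldType) (V : vectType F).
Implicit Types (A E G P T U X : {vspace V}) (B I S Egg Fam : {set {vspace V}}).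

Definition points U : {set {vspace V}} :=
  [set P | (\dim P == 1%N) && (P <= U)%VS].

Definition affine_points U A : {set {vspace V}} :=
  [set P in points U | ~~ (P <= A)%VS].

Definition is_spread (k : nat) U S : Prop :=
  (forall X, X \in S -> \dim X = k.+1 /\ (X <= U)%VS) /\
  (forall P, P \in points U -> exists! X, X \in S /\ (P <= X)%VS).

Definition is_tangent_space (m : nat) Egg E T : bool :=
  [&& \dim T == (3 * m)%N, (E <= T)%VS &
      [forall E' in Egg :\ E, (T :&: E' == 0)%VS]].

(* The existence of a unique tangent space at every element is part of the
   notion of an egg. *)
Definition is_egg (m : nat) Egg : Prop :=
  [/\ #|Egg| = (#|F| ^ (2 * m)).+1,
      forall E, E \in Egg -> \dim E = m,
      forall E1 E2, E1 \in Egg -> E2 \in Egg -> E1 != E2 ->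
        (E1 :&: E2 = 0)%VS,
      forall E1 E2 E3, E1 \in Egg -> E2 \in Egg -> E3 \in Egg ->
        E1 != E2 -> E1 != E3 -> E2 != E3 -> \dim (E1 + E2 + E3)%VS = (3 * m)%N &
      forall E, E \in Egg -> exists! T, is_tangent_space m Egg E T].

(* When Egg is an egg and E is one of its elements, this is the tangent space
   of Egg at E; the default value 0 is then irrelevant. *)
Definition tangent (m : nat) Egg E : {vspace V} :=
  odflt 0%VS [pick T | is_tangent_space m Egg E T].

Definition egg_points Egg Einf G : {set {vspace V}} :=
  [set (E :&: G)%VS | E in Egg :\ Einf].

Definition egg_traces (m : nat) Egg Einf : {set {vspace V}} :=
  [set (tangent m Egg E :&: tangent m Egg Einf)%VS | E in Egg :\ Einf].

Definition egg_family (m : nat) Egg Einf G : {set {vspace V}} :=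
  [set X : {vspace V} |
    [&& \dim X == (2 * m).+1, (X <= G)%VS, ~~ (X <= tangent m Egg Einf)%VS &
        [exists Y in egg_traces m Egg Einf, (Y <= X)%VS]]].

Definition minimal_blocking_set G A Fam B : Prop :=
  [/\ B \subset affine_points G A,
      forall X, X \in Fam -> exists2 P, P \in B & (P <= X)%VS &
      forall P, P \in B -> exists X,
        [/\ X \in Fam, (P <= X)%VS &
            forall Q, Q \in B -> (Q <= X)%VS -> Q = P]].

Definition spread_traces S z (Vz : {vspace V}) A : {set {vspace V}} :=
  [set ((x + Vz) :&: A)%VS | x in S :\ z].

(* z is added as a single element: it is one point (at infinity) of the
   Bruck-Bose plane. *)
Definition cone_set (Sigma : {vspace V}) B z (Vz : {vspace V})
    : {set {vspace V}} :=
  z |: \bigcup_(P in B) affine_points (P + Vz)%VS Sigma.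

End Subspaces.

(* An incidence structure whose points and lines are the elements of given
   subsets of ambient finite types. *)
Record incidence_structure (pT lT : finType) := IncidenceStructure {
  point_set : {set pT};
  line_set : {set lT};
  incident : pT -> lT -> bool
}.

Section Planes.
Variables (pT lT : finType) (Pi : incidence_structure pT lT).

Definition points_on (l : lT) : {set pT} :=
  [set p in point_set Pi | incident Pi p l].

Definition is_projective_plane (n : nat) : Prop :=
  [/\ forall p p', p \in point_set Pi -> p' \in point_set Pi -> p != p' ->
        exists! l, [/\ l \in line_set Pi, incident Pi p l & incident Pi p' l],
      forall l l', l \in line_set Pi -> l' \in line_set Pi -> l != l' ->
        exists! p, [/\ p \in point_set Pi, incident Pi p l & incident Pi p l'],
      exists Q : {set pT}, [/\ Q \subset point_set Pi, #|Q| = 4 &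
        forall l, l \in line_set Pi -> #|Q :&: points_on l| <= 2] &
      forall l, l \in line_set Pi -> #|points_on l| = n.+1].

Definition is_unital (n : nat) (B : {set pT}) : Prop :=
  [/\ is_projective_plane (n ^ 2),
      B \subset point_set Pi,
      #|B| = (n ^ 3).+1 &
      forall l, l \in line_set Pi ->
        #|B :&: points_on l| = 1%N \/ #|B :&: points_on l| = n.+1].

End Planes.

(* The line None is the line at infinity, i.e. the spread S itself. *)
Definition bruck_bose_plane (F : finFieldType) (W : vectType F) (m : nat)
    (Sigma : {vspace W}) (S : {set {vspace W}}) :
    incidence_structure {vspace W} (option {vspace W}) := {|
  point_set := affine_points fullv Sigma :|: S;
  line_set := None |: [set Some L | L : {vspace W} &
    [&& \dim L == (2 * m).+1, ~~ (L <= Sigma)%VS & (L :&: Sigma)%VS \in S]];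
  incident := fun X l => if l is Some L then (X <= L)%VS else X \in S
|}.

(* Main.v *)
(* The plane has order n^2 with n = q^m, and the cone has n^3 + 1 points: the
   vertex z and n affine points on each of the n^2 generators.  A set of n^3 + 1
   points in a plane of order n^2 with a tangent at each of its points is a
   unital (Bruen and Thas), so only the tangents are needed.  The line at
   infinity is tangent at z.  At an affine point Q of <P, Vz>, minimality gives
   a member X of the family meeting the base only in P; X contains
   <x, Vz> :&: E_infty^* for some spread element x, and <Q, x> is tangent. *)
Require Import Defs.
From mathcomp Require Import all_boot all_order all_algebra all_field.
From mathcomp Require Import zify.

Set Implicit Arguments.
Unset Strict Implicit.
Unset Printing Implicit Defensive.

(** * Unitals in projective planes *)

Section Counting.
Variables S T : finType.

Lemma double_count (A : {set S}) (B : {set T}) (R : S -> T -> bool) :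
  \sum_(a in A) #|[set b in B | R a b]| =
  \sum_(b in B) #|[set a in A | R a b]|.
Proof.
under eq_bigr do rewrite -sum1_card.
under [RHS]eq_bigr do rewrite -sum1_card.
rewrite (exchange_big_dep (mem B)) /= => [|a b _]; last by rewrite inE => /andP[].
apply: eq_bigr => b Bb; apply: eq_bigl => a.
by rewrite !inE Bb.
Qed.

Lemma card_unique (P : pred T) : (exists! x, P x) -> #|[set x | P x]| = 1.
Proof.
case=> x [Px uniq_x]; apply/eqP/cards1P; exists x.
by apply/setP => y; rewrite !inE; apply/idP/eqP => [/uniq_x|->].
Qed.

End Counting.

Section ProjectivePlane.
Variables (pT lT : finType) (Pi : incidence_structure pT lT).
Implicit Types (p : pT) (l : lT) (B : {set pT}).

Definition lines_through p : {set lT} := [set l in line_set Pi | incident Pi p l].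

(** Only the join axiom is assumed, so that the lemma can already serve while an incidence structure
    is being shown to be a plane. *)
Lemma incident_uniq p p' l l' :
    (forall p p', p \in point_set Pi -> p' \in point_set Pi -> p != p' ->
      exists! l, [/\ l \in line_set Pi, incident Pi p l & incident Pi p' l]) ->
    p \in point_set Pi -> p' \in point_set Pi ->
    l \in line_set Pi -> l' \in line_set Pi ->
    incident Pi p l -> incident Pi p' l -> incident Pi p l' -> incident Pi p' l' ->
  l != l' -> p = p'.
Proof.
move=> join Pp Pp' Ll Ll' pl p'l pl' p'l'.
apply: contraNeq => /(join _ _ Pp Pp')[k [_ uniq_k]].
by apply/eqP; rewrite -(uniq_k l) // -(uniq_k l').
Qed.

(** Take two points besides [p] on each of two lines through [p]. Each of these lines misses the
    pair chosen on the other, and any third line meets each pair at most once. *)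
Lemma exists_quadrangle :
    (forall p p', p \in point_set Pi -> p' \in point_set Pi -> p != p' ->
      exists! l, [/\ l \in line_set Pi, incident Pi p l & incident Pi p' l]) ->
    (forall l, l \in line_set Pi -> 2 < #|points_on Pi l|) ->
    (exists l l' p, [/\ l \in line_set Pi, l' \in line_set Pi, l != l',
       p \in points_on Pi l & p \in points_on Pi l']) ->
  exists Q : {set pT}, [/\ Q \subset point_set Pi, #|Q| = 4 &
    forall l, l \in line_set Pi -> #|Q :&: points_on Pi l| <= 2].
Proof.
move=> join big_lines [l [l' [p [Ll Ll' ll' pl pl']]]].
have meet k k' x y : k \in line_set Pi -> k' \in line_set Pi -> k != k' ->
    x \in points_on Pi k -> x \in points_on Pi k' ->
    y \in points_on Pi k -> y \in points_on Pi k' -> x = y.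
  rewrite !inE => Lk Lk' kk' /andP[Px xk] /andP[_ xk'] /andP[Py yk] /andP[_ yk'].
  exact: (incident_uniq join Px Py Lk Lk').
have two_more k : k \in line_set Pi -> p \in points_on Pi k ->
    exists A : {set pT}, [/\ A \subset points_on Pi k, p \notin A & #|A| = 2].
  move=> Lk pk; have := big_lines k Lk; rewrite (cardsD1 p) pk ltnS => /card_geqP.
  case=> s [uniq_s size_s sub_s]; exists [set x in s]; split.
  - by apply/subsetP=> x; rewrite inE => /sub_s /setD1P[].
  - by apply/negP; rewrite inE => /sub_s; rewrite !inE eqxx.
  - by rewrite cardsE (card_uniqP uniq_s).
have [A [Al pA cA]] := two_more l Ll pl.
have [B [Bl' pB cB]] := two_more l' Ll' pl'.
have disj (C : {set pT}) k k' : k \in line_set Pi -> k' \in line_set Pi -> k != k' ->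
    C \subset points_on Pi k -> p \notin C ->
    p \in points_on Pi k -> p \in points_on Pi k' -> C :&: points_on Pi k' = set0.
  move=> Lk Lk' kk' Ck pC pk pk'; apply/setP=> x; rewrite in_set0.
  apply/negP => /setIP[Cx xk']; case/negP: pC.
  by rewrite (meet k k' p x) // (subsetP Ck).
have one (C : {set pT}) k k' : k \in line_set Pi -> k' \in line_set Pi -> k != k' ->
    C \subset points_on Pi k -> #|C :&: points_on Pi k'| <= 1.
  move=> Lk Lk' kk' Ck; apply/card_le1_eqP => x y /setIP[Cx xk'] /setIP[Cy yk'].
  by rewrite (meet k k' x y) // (subsetP Ck).
exists (A :|: B); split.
- by rewrite subUset; apply/andP; split; apply/subsetP=> x;
    [move/(subsetP Al)|move/(subsetP Bl')]; rewrite inE => /andP[].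
- rewrite cardsU cA cB (_ : A :&: B = set0) ?cards0 //.
  by apply/eqP; rewrite -subset0 -(disj A l l') // setIS.
move=> k Lk; rewrite setIUl; have [<-|lk] := eqVneq l k.
  rewrite (disj B l' l) // 1?eq_sym // setU0.
  by rewrite (leq_trans (subset_leq_card (subsetIl _ _))) ?cA.
have [<-|l'k] := eqVneq l' k.
  rewrite (disj A l l') // set0U.
  by rewrite (leq_trans (subset_leq_card (subsetIl _ _))) ?cB.
rewrite (leq_trans (leq_card_setU _ _).1) // (@leq_add _ _ 1 1) //.
  exact: (one A l).
exact: (one B l').
Qed.

(** * Standard counts in a projective plane of order [N] *)

Section Degrees.
Variable N : nat.
Hypothesis plane : is_projective_plane Pi N.

Lemma card_joining_lines p p' :
    p \in point_set Pi -> p' \in point_set Pi -> p != p' ->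
  #|[set l in lines_through p | incident Pi p' l]| = 1.
Proof.
case: plane => join _ _ _ Pp Pp' pp'; rewrite -[RHS](card_unique (P := fun l =>
  [&& l \in line_set Pi, incident Pi p l & incident Pi p' l])); last first.
  have [l [[Ll pl p'l] uniq_l]] := join p p' Pp Pp' pp'.
  by exists l; split=> [|k /and3P[? ? ?]]; [apply/and3P | apply: uniq_l].
by apply: eq_card => l; rewrite !inE andbA.
Qed.

(** Three points of a quadrangle form a triangle, and the three sides of a triangle have no common
    point. *)
Lemma exists_line_avoiding p :
  p \in point_set Pi -> exists2 l, l \in line_set Pi & ~~ incident Pi p l.
Proof.
case: plane => join _ [Q [QP cQ Q2]] _ Pp.
have /card_geqP[s [uniq_s size_s sub_s]] : 2 < #|Q| by rewrite cQ.
case: s size_s uniq_s sub_s => [|a [|b [|c []]]] //= _.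
rewrite !inE negb_or => /and3P[/andP[ab ac] bc _] sub_s.
have [Qa Qb Qc] : [/\ a \in Q, b \in Q & c \in Q].
  by split; apply: sub_s; rewrite !inE eqxx ?orbT.
have [Pa Pb Pc] : [/\ a \in point_set Pi, b \in point_set Pi & c \in point_set Pi].
  by split; apply: (subsetP QP).
have no_abc l : l \in line_set Pi ->
    ~ [/\ incident Pi a l, incident Pi b l & incident Pi c l].
  move=> Ll [al bl cl]; have := Q2 l Ll; rewrite leqNgt => /negP[].
  apply/card_geqP; exists [:: a; b; c]; split=> //.
    by rewrite /= !inE negb_or ab ac bc.
  by move=> x; rewrite !inE => /or3P[] /eqP->; rewrite ?Qa ?Qb ?Qc ?Pa ?Pb ?Pc.
have [k [[Lk bk ck] _]] := join b c Pb Pc bc.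
have [l [[Ll al bl] _]] := join a b Pa Pb ab.
have [l' [[Ll' al' cl'] _]] := join a c Pa Pc ac.
have [pk|] := boolP (incident Pi p k); last by exists k.
have [pl|] := boolP (incident Pi p l); last by exists l.
have [pl'|] := boolP (incident Pi p l'); last by exists l'.
have ll' : l != l'.
  by apply/eqP=> ll'; apply: (no_abc l Ll); split=> //; rewrite ll'.
(* The sides ab and ac share only the vertex a, so [p] is a; but then the side bc would pass through
   a. *)
have pa := incident_uniq join Pp Pa Ll Ll' pl al pl' al' ll'.
by case: (no_abc k Lk); rewrite -pa.
Qed.

(** Joining and intersecting match the lines through [p] with the points of a line [l] that avoids
    [p]. *)
Lemma card_lines_through p : p \in point_set Pi -> #|lines_through p| = N.+1.
Proof.
move=> Pp; have [l Ll pl] := exists_line_avoiding Pp.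
case: plane => join meet _ cl; rewrite -(cl l Ll).
have := double_count (points_on Pi l) (lines_through p) (incident Pi).
under eq_bigr => p' .
  rewrite inE => /andP[Pp' p'l]; rewrite card_joining_lines //; last first.
    by apply: contraNneq pl => ->.
  over.
rewrite sum_nat_const muln1 => ->; rewrite -sum1_card; apply: eq_bigr => k.
rewrite inE => /andP[Lk pk].
have lk : l != k by apply: contraNneq pl => ->.
have [x [[Px xl xk] uniq_x]] := meet l k Ll Lk lk.
rewrite -[LHS](card_unique (P := fun r =>
  [&& r \in point_set Pi, incident Pi r l & incident Pi r k])).
  by apply: eq_card => r; rewrite !inE andbA.
by exists x; split=> [|y /and3P[? ? ?]]; [apply/and3P | apply: uniq_x].
Qed.

(** Every point of [B] other than [p] lies on exactly one line through [p]. *)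
Lemma sum_card_pencil B p : B \subset point_set Pi -> p \in point_set Pi ->
  \sum_(l in lines_through p) #|(B :&: points_on Pi l) :\ p| = #|B :\ p|.
Proof.
move=> BP Pp; rewrite -[RHS]sum1_card.
have := double_count (B :\ p) (lines_through p) (incident Pi).
rewrite (eq_bigr (fun=> 1)) => [->|p']; last first.
  rewrite !inE => /andP[p'p Bp'].
  by rewrite card_joining_lines 1?eq_sym // (subsetP BP).
apply: eq_bigr => l _; apply: eq_card => x; rewrite !inE.
have [Bx|] := boolP (x \in B); rewrite ?andbF //=.
by rewrite (subsetP BP) // andbT.
Qed.

(** The pencil of one point has [N.+1] lines, each with [N] further points. *)
Lemma card_point_set : #|point_set Pi| = (N ^ 2 + N).+1.
Proof.
case: (plane) => _ _ [Q [QP cQ _]] cl.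
have /card_gt0P[p /(subsetP QP) Pp] : 0 < #|Q| by rewrite cQ.
have := sum_card_pencil (subxx _) Pp.
rewrite (eq_bigr (fun=> N)) => [|l]; last first.
  rewrite inE => /andP[Ll pl]; have := cl l Ll.
  have -> : point_set Pi :&: points_on Pi l = points_on Pi l.
    by apply/setIidPr/subsetP => x; rewrite inE => /andP[].
  by rewrite (cardsD1 p) inE Pp pl => -[].
by rewrite sum_nat_const card_lines_through // (cardsD1 p (point_set Pi)) Pp => <-; lia.
Qed.

Lemma sum_card_secants B : B \subset point_set Pi ->
  \sum_(l in line_set Pi) #|B :&: points_on Pi l| = #|B| * N.+1.
Proof.
move=> BP; have := double_count B (line_set Pi) (incident Pi).
rewrite (eq_bigr (fun=> N.+1)) => [|p /(subsetP BP)/card_lines_through //].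
rewrite sum_nat_const => ->; apply: eq_bigr => l _; apply: eq_card => x.
rewrite !inE; have [Bx|] := boolP (x \in B) => //=.
by rewrite (subsetP BP).
Qed.

Lemma card_line_set : #|line_set Pi| = (N ^ 2 + N).+1.
Proof.
have := sum_card_secants (subxx (point_set Pi)).
rewrite (eq_bigr (fun=> N.+1)) => [|l Ll]; last first.
  case: plane => _ _ _ /(_ l Ll) <-; congr #|pred_of_set _|.
  by apply/setIidPr/subsetP => x; rewrite inE => /andP[].
by rewrite sum_nat_const card_point_set => /eqP; rewrite eqn_pmul2r // => /eqP.
Qed.

(** Both sides count ordered pairs of distinct points of [B], each pair lying on a single line. *)
Lemma sum_card_flag_pairs B : B \subset point_set Pi ->
  \sum_(l in line_set Pi) #|B :&: points_on Pi l| * #|B :&: points_on Pi l|.-1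
  = #|B| * #|B|.-1.
Proof.
move=> BP.
have -> : #|B| * #|B|.-1 = \sum_(p in B) \sum_(l in lines_through p)
    #|(B :&: points_on Pi l) :\ p|.
  rewrite -sum_nat_const; apply: eq_bigr => p Bp.
  by rewrite sum_card_pencil ?(subsetP BP) // (cardsD1 p) Bp.
rewrite (exchange_big_dep (mem (line_set Pi))) /= => [|p l _]; last first.
  by rewrite inE => /andP[].
apply: eq_bigr => l Ll; rewrite -sum_nat_const; apply: eq_big => p.
  by rewrite !inE Ll; have [/(subsetP BP)->|] := boolP (p \in B).
by move=> Bp; rewrite [in LHS](cardsD1 p) Bp.
Qed.

End Degrees.

(* With a_l = #|B :&: l|, every line that is not tangent contributes to the sum
   of the (a_l - (n + 1))^2, whose total over all lines is n^2 (n^3 + 1); the at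
   least n^3 + 1 tangents already account for all of it. *)
Lemma unital_of_tangents n B :
    is_projective_plane Pi (n ^ 2) -> B \subset point_set Pi -> #|B| = (n ^ 3).+1 ->
    (forall p, p \in B ->
      exists2 l, l \in line_set Pi & B :&: points_on Pi l = [set p]) ->
  is_unital Pi n B.
Proof.
move=> plane BP cB tangents; split=> // l Ll.
pose a k := #|B :&: points_on Pi k|; rewrite -/(a l).
have le_tan : #|B| <= #|[set k in line_set Pi | a k == 1]|.
  have := double_count B [set k in line_set Pi | a k == 1] (incident Pi).
  rewrite [X in _ = X](eq_bigr (fun=> 1)) => [|k].
    rewrite sum1_card => <-; rewrite -sum1_card; apply: leq_sum => p Bp.
    have [k Lk Bk] := tangents p Bp.
    apply/card_gt0P; exists k; rewrite !inE Lk /a Bk cards1 eqxx.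
    by have := set11 p; rewrite -Bk !inE => /and3P[].
  rewrite inE => /andP[Lk /eqP <-]; apply: eq_card => x.
  by rewrite !inE; have [/(subsetP BP)->|] := boolP (x \in B).
have s0 := card_line_set plane.
have s1 := sum_card_secants plane BP.
have s2 := sum_card_flag_pairs plane BP.
rewrite cB in le_tan s1 s2.
(* Subtraction is truncated: one of the two differences is 0, so their sum is the absolute
   difference of [a k] and [n.+1]. *)
pose d k := (a k - n.+1 + (n.+1 - a k)) ^ 2.
(* The expansion of the square, with the negative term moved to the left to stay within the
   naturals. *)
have dE k : d k + (2 * n + 1) * a k = a k * (a k).-1 + n.+1 ^ 2.
  rewrite /d; case: (a k) => [|c] /=; nia.
(* There are n^4 + n^2 + 1 lines; the incidences total (n^3 + 1)(n^2 + 1) and the ordered pairs (n^3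
   + 1) n^3. *)
have sum_d : \sum_(k in line_set Pi) d k = n ^ 2 * (n ^ 3).+1.
  have : \sum_(k in line_set Pi) (d k + (2 * n + 1) * a k) =
         \sum_(k in line_set Pi) (a k * (a k).-1 + n.+1 ^ 2).
    by apply: eq_bigr.
  rewrite !big_split /= -big_distrr /= s1 s2 sum_nat_const s0 /=; nia.
have [al|al] := eqVneq (a l) 1; [by left | right].
suff: d l = 0 by rewrite /d; lia.
(* Each tangent contributes n^2, so the tangents alone reach n^2 (n^3 + 1); the non-tangent [l] adds
   [d l] on top of this within the same total. *)
apply/eqP; rewrite -leqn0 -(leq_add2l (n ^ 2 * (n ^ 3).+1)) addn0 -[leqRHS]sum_d.
rewrite (bigID (fun k => a k == 1)) /=; apply: leq_add.
  rewrite (eq_bigr (fun=> n ^ 2)) => [|k /andP[_ /eqP ak]]; last first.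
    by rewrite /d ak; nia.
  rewrite sum_nat_const mulnC leq_mul2r; apply/orP; right.
  by rewrite (leq_trans le_tan) // subset_leq_card //; apply/subsetP => k; rewrite inE.
by rewrite (bigD1 l) /= ?Ll ?al // leq_addr.
Qed.

End ProjectivePlane.

(** * Counting points of subspaces and spreads *)

Section Subspaces.
Variables (F : finFieldType) (V : vectType F).
Implicit Types (A P U W X : {vspace V}) (S : {set {vspace V}}).

Lemma dim1_vline P : \dim P = 1 -> P = <[vpick P]>%VS.
Proof.
move=> dP; apply/esym/eqP; rewrite eqEdim -memvE memv_pick dP dim_vline vpick0.
by rewrite -dimv_eq0 dP.
Qed.

Lemma cap_dim1 P U : \dim P = 1 -> ~~ (P <= U)%VS -> (P :&: U = 0)%VS.
Proof.
move=> dP PU; apply/eqP; rewrite -dimv_eq0.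
have := dimv_leqif_eq (capvSl P U); rewrite dP => -[le1 eq1].
have : \dim (P :&: U) != 1.
  by rewrite eq1; apply: contraNneq PU => <-; rewrite capvSr.
lia.
Qed.

Lemma affine_pointsP U A P :
  reflect [/\ \dim P = 1, (P <= U)%VS & ~~ (P <= A)%VS] (P \in affine_points U A).
Proof.
rewrite !inE; apply: (iffP andP) => [[/andP[/eqP-> ->] ->] | [-> -> ->]] //.
Qed.

(** If p + u = k (p + u'), then (1 - k) p lies in [A], which forces k = 1 as [p] is outside [A]. *)
Lemma vline_translate_inj A (p u u' : V) :
  p \notin A -> u \in A -> u' \in A -> <[p + u]>%VS = <[p + u']>%VS -> u = u'.
Proof.
move=> Ap Au Au' /eqP; rewrite eqEsubv -memvE => /andP[/vlineP[k puE] _].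
have A1kp : ((1 - k) *: p \in A)%R.
  have -> : ((1 - k) *: p = k *: u' - u)%R.
    apply/eqP; rewrite GRing.scalerBl GRing.scale1r GRing.subr_eq GRing.addrAC.
    by rewrite -GRing.scalerDr [(u' + p)%R]GRing.addrC -puE GRing.addrK.
  by rewrite memvB ?memvZ.
have [k1|k1] := eqVneq (1 - k)%R 0%R.
  by move: puE; rewrite -(GRing.subr0_eq k1) GRing.scale1r => /GRing.addrI.
case/negP: Ap; rewrite -[p]GRing.scale1r -(GRing.mulVf k1) -GRing.scalerA.
exact: memvZ.
Qed.

Lemma card_vectors U : #|[set u : finvect_type V | u \in U]| = #|F| ^ \dim U.
Proof.
rewrite cardsE.
by case: V U => vT cvT U; apply: (@card_vspace F (finvect_type (Vector.Pack cvT)) cvT).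
Qed.

(** Here [A] cuts [U] in a hyperplane. For a fixed vector p of [U] outside [A], the affine points
    are the lines spanned by p + u with u in [U :&: A], one for each u. *)
Lemma card_affine_points U A :
  \dim U = (\dim (U :&: A)).+1 -> #|affine_points U A| = #|F| ^ \dim (U :&: A).
Proof.
move=> dU.
have /subvPn[p Up Ap] : ~~ (U <= A)%VS.
  by apply/negP => /capv_idPl UA; move: dU; rewrite UA; lia.
have p0 : p != 0%R by apply: contraNneq Ap => ->; apply: mem0v.
have Upl : (<[p]> + (U :&: A) = U)%VS.
  apply/eqP; rewrite eqEdim subv_add -memvE Up capvSl dU.
  rewrite dimv_disjoint_sum ?dim_vline; last first.
    by rewrite cap_dim1 ?subv_cap -?memvE ?(negPf Ap) ?andbF ?dim_vline ?p0.
  by rewrite p0 ltnSn.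
pose D := [set u : finvect_type V | u \in (U :&: A)%VS].
have -> : affine_points U A = [set <[p + u]>%VS | u : finvect_type V in D].
  apply/setP=> P; apply/affine_pointsP/imsetP => [[dP PU PA] | [u]].
    have Pv := dim1_vline dP; have Uv : vpick P \in U by rewrite (subvP PU) ?memv_pick.
    have : vpick P \in (<[p]> + (U :&: A))%VS by rewrite Upl.
    case/memv_addP=> _ /vlineP[k ->] [u UAu vE].
    have k0 : k != 0%R.
      apply: contraNneq PA => k0; rewrite Pv -memvE vE k0 GRing.scale0r GRing.add0r.
      by case/memv_capP: UAu.
    (* The generator of [P] is rescaled so that its coefficient at [p] becomes 1. *)
    exists (k^-1 *: u)%R; first by rewrite inE; apply: memvZ.
    have wE : (vpick P = k *: (p + k^-1 *: u))%R.
      by rewrite GRing.scalerDr GRing.scalerA GRing.mulfV // GRing.scale1r.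
    apply/eqP; rewrite eqEdim dP dim_vline leq_b1 andbT.
    by rewrite [in X in (X <= _)%VS]Pv -memvE wE memvZ ?memv_line.
  rewrite inE => /memv_capP[Uu Au] ->.
  have Apu : (p + (u : V))%R \notin A.
    by apply: contra Ap => Apu; rewrite -(GRing.addrK u p) memvB.
  split; rewrite -?memvE //; last exact: memvD.
  by rewrite dim_vline (_ : _ != _) //; apply: contraNneq Apu => ->; apply: mem0v.
rewrite card_in_imset => [|u u']; first exact: card_vectors.
rewrite !inE => /memv_capP[_ Au] /memv_capP[_ Au'].
exact: (@vline_translate_inj A).
Qed.

(** * Spreads as partitions of the nonzero vectors *)

Section Spread.
Variables (k : nat) (U : {vspace V}) (S : {set {vspace V}}).
Hypothesis spreadS : is_spread k U S.

Lemma spread_sub X : X \in S -> (X <= U)%VS.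
Proof. by case: spreadS => + _ => /[apply] -[]. Qed.

Lemma dim_spread X : X \in S -> \dim X = k.+1.
Proof. by case: spreadS => + _ => /[apply] -[]. Qed.

Lemma spread_neq0 X : X \in S -> X != 0%VS.
Proof. by move/dim_spread; rewrite -dimv_eq0 => ->. Qed.

Lemma spread_vector u : u \in U -> u != 0%R -> exists! X, (X \in S) && (u \in X).
Proof.
move=> Uu u0; case: spreadS => _ /(_ <[u]>%VS)[].
  by rewrite inE dim_vline u0 -memvE.
move=> X [[SX uX] uniqX]; exists X; split; first by rewrite SX.
by move=> Y /andP[SY Yu]; apply: uniqX; rewrite -memvE.
Qed.

Lemma mem_spread_uniq u X Y :
  u != 0%R -> X \in S -> Y \in S -> u \in X -> u \in Y -> X = Y.
Proof.
move=> u0 SX SY Xu Yu.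
have [//|Z [_ uniqZ]] := spread_vector _ u0; first exact: (subvP (spread_sub SX)).
by apply: etrans (uniqZ Y _); [apply/esym/uniqZ |]; apply/andP.
Qed.

Lemma spread_cap0 X Y : X \in S -> Y \in S -> X != Y -> (X :&: Y = 0)%VS.
Proof.
move=> SX SY; apply: contraNeq; rewrite -vpick0 => u0; apply/eqP.
have /memv_capP[Xu Yu] := memv_pick (X :&: Y).
exact: mem_spread_uniq u0 SX SY Xu Yu.
Qed.

Lemma spread_subv_eq X Y : X \in S -> Y \in S -> (X <= Y)%VS -> X = Y.
Proof.
move=> SX SY XY; apply: contraTeq isT => /(spread_cap0 SX SY).
by rewrite (capv_idPl XY) => /eqP; rewrite (negPf (spread_neq0 SX)).
Qed.

(** Count the nonzero vectors of [U] by the spread element containing each; the product form avoids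
    a division. *)
Lemma card_spread : #|S| * (#|F| ^ k.+1).-1 = (#|F| ^ \dim U).-1.
Proof.
pose nz X := [set u : finvect_type V | (u \in X) && (u != 0%R)].
have card_nz X : #|nz X| = (#|F| ^ \dim X).-1.
  pose D := [set u : finvect_type V | u \in X].
  have D0 : (0%R : finvect_type V) \in D by rewrite inE; apply: mem0v.
  have := cardsD1 (0%R : finvect_type V) D; rewrite D0 [#|D|]card_vectors => ->.
  by apply: eq_card => u; rewrite !inE andbC.
rewrite -card_nz -[RHS]sum1_card.
have := double_count S (nz U) (fun X (u : V) => u \in X).
rewrite (eq_bigr (fun=> (#|F| ^ k.+1).-1)) => [|X SX]; last first.
  rewrite -(dim_spread SX) -card_nz; apply: eq_card => u; rewrite !inE.
  have [Xu|] := boolP (u \in X); rewrite ?andbF //=.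
  by rewrite (subvP (spread_sub SX)) // andbT.
rewrite sum_nat_const => ->; apply: eq_bigr => u; rewrite inE => /andP[Uu u0].
by rewrite card_unique //; apply: spread_vector.
Qed.

End Spread.

End Subspaces.

(** * Bruck-Bose planes and cones *)

Section BruckBose.
Variables (F : finFieldType) (W : vectType F) (m : nat).
Variables (Sigma : {vspace W}) (S : {set {vspace W}}).
Hypotheses (m_gt0 : 0 < m) (dimW : \dim {:W} = (4 * m).+1).
Hypotheses (dimSigma : \dim Sigma = 4 * m) (spreadS : is_spread (2 * m - 1) Sigma S).
Implicit Types (L P Q R U x y : {vspace W}).
Local Notation plane := (bruck_bose_plane m Sigma S).

Lemma bb_dim_spread x : x \in S -> \dim x = 2 * m.
Proof. by move/(dim_spread spreadS)->; lia. Qed.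

(** [Sigma] is a hyperplane, so [U + Sigma] is the whole space and the dimension formula applies. *)
Lemma dim_cap_hyperplane U : ~~ (U <= Sigma)%VS -> \dim U = (\dim (U :&: Sigma)).+1.
Proof.
move=> US; have := dimv_sum_cap U Sigma.
have : \dim (U + Sigma) <= \dim {:W} by rewrite dimvS ?subvf.
have := dimv_leqif_sup (addvSr U Sigma); rewrite subv_add subvv andbT (negPf US).
by case=> le1 ne1; lia.
Qed.

Lemma affineP P :
  reflect (\dim P = 1 /\ ~~ (P <= Sigma)%VS) (P \in affine_points fullv Sigma).
Proof.
by apply: (iffP (affine_pointsP _ _ _)) => [[]|[]]; rewrite ?subvf.
Qed.

Lemma affine_notin_spread P : P \in affine_points fullv Sigma -> P \notin S.
Proof. by case/affineP=> _; apply: contra => /(spread_sub spreadS). Qed.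

Lemma mem_bb_line L : (Some L \in line_set plane) =
  [&& \dim L == (2 * m).+1, ~~ (L <= Sigma)%VS & (L :&: Sigma)%VS \in S].
Proof. by rewrite !inE /= mem_imset ?inE // => ? ? []. Qed.

Lemma join_cap_Sigma P U :
  P \in affine_points fullv Sigma -> (U <= Sigma)%VS -> ((P + U) :&: Sigma)%VS = U.
Proof.
by case/affineP=> dP PS US; rewrite addvC -vspace_modl // cap_dim1 ?addv0.
Qed.

Lemma join_notin_Sigma P U :
  P \in affine_points fullv Sigma -> ~~ (P + U <= Sigma)%VS.
Proof. by case/affineP=> _ PS; rewrite subv_add (negPf PS). Qed.

Lemma dim_join P x : P \in affine_points fullv Sigma -> x \in S ->
  \dim (P + x)%VS = (2 * m).+1.
Proof.
move=> Pa Sx; rewrite (dim_cap_hyperplane (join_notin_Sigma _ Pa)).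
by rewrite (join_cap_Sigma Pa (spread_sub spreadS Sx)) (bb_dim_spread Sx).
Qed.

Lemma join_bb_line P x : P \in affine_points fullv Sigma -> x \in S ->
  Some (P + x)%VS \in line_set plane.
Proof.
move=> Pa Sx; rewrite mem_bb_line (dim_join Pa Sx) eqxx join_notin_Sigma //.
by rewrite (join_cap_Sigma Pa (spread_sub spreadS Sx)).
Qed.

(** A line is recovered from one affine point and its point at infinity, the two subspaces having
    the same dimension. Uniqueness of joining lines rests on this. *)
Lemma bb_line_eq_join P L : P \in affine_points fullv Sigma ->
  Some L \in line_set plane -> (P <= L)%VS -> L = (P + (L :&: Sigma))%VS.
Proof.
move=> Pa; rewrite mem_bb_line => /and3P[/eqP dL _ SL] PL; apply/esym/eqP.
by rewrite eqEdim dim_join // dL leqnn subv_add PL capvSl.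
Qed.

Lemma spread_on_bb_line x L : Some L \in line_set plane -> x \in S ->
  (x <= L)%VS -> x = (L :&: Sigma)%VS.
Proof.
rewrite mem_bb_line => /and3P[_ _ SL] Sx xL.
by apply: (spread_subv_eq spreadS); rewrite ?subv_cap ?xL ?(spread_sub spreadS).
Qed.

Lemma bb_join_affine_spread P x : P \in affine_points fullv Sigma -> x \in S ->
  exists! l, [/\ l \in line_set plane, incident plane P l & incident plane x l].
Proof.
move=> Pa Sx; exists (Some (P + x)%VS); split.
  by rewrite join_bb_line //=; split; rewrite // ?addvSl ?addvSr.
case=> [L|] [Ll PL xL]; last by move: PL; rewrite /= (negPf (affine_notin_spread Pa)).
by rewrite (bb_line_eq_join Pa Ll PL) -(spread_on_bb_line Ll Sx xL).
Qed.

Lemma bb_join_spread x y : x \in S -> y \in S -> x != y ->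
  exists! l, [/\ l \in line_set plane, incident plane x l & incident plane y l].
Proof.
move=> Sx Sy xy; exists None; split; first by rewrite !inE.
case=> [L|] // [Ll xL yL]; case/eqP: xy.
by rewrite (spread_on_bb_line Ll Sx xL) -(spread_on_bb_line Ll Sy yL).
Qed.

(** The projective line through [P] and [Q] meets [Sigma] in a point [R]; the spread element on [R]
    is the point at infinity of the join. *)
Lemma bb_join_affine P Q :
    P \in affine_points fullv Sigma -> Q \in affine_points fullv Sigma -> P != Q ->
  exists! l, [/\ l \in line_set plane, incident plane P l & incident plane Q l].
Proof.
move=> Pa Qa PQ; have [[dP PS] [dQ QS]] := (affineP _ Pa, affineP _ Qa).
have dPQ : \dim (P + Q) = 2.
  rewrite dimv_disjoint_sum ?dP ?dQ // cap_dim1 //.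
  by apply: contra PQ => PQ; rewrite eqEdim PQ dP dQ.
have notPQS : ~~ (P + Q <= Sigma)%VS by rewrite subv_add (negPf PS).
pose R := ((P + Q) :&: Sigma)%VS.
have dR : \dim R = 1 by have := dim_cap_hyperplane notPQS; rewrite dPQ => -[].
have PR : (P + R = P + Q)%VS.
  apply/eqP; rewrite eqEdim subv_add addvSl capvSl dPQ dimv_disjoint_sum ?dP ?dR //.
  by rewrite cap_dim1 // subv_cap (negPf PS) andbF.
have [x [[Sx Rx] uniq_x]] : exists! x, x \in S /\ (R <= x)%VS.
  by case: spreadS => _; apply; rewrite inE dR capvSr.
exists (Some (P + x)%VS); split.
  rewrite join_bb_line //=; split; rewrite // ?addvSl //.
  by rewrite (subv_trans (addvSr P Q)) // -PR addvS.
case=> [L|] [Ll PL QL]; last by move: PL; rewrite /= (negPf (affine_notin_spread Pa)).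
rewrite (bb_line_eq_join Pa Ll PL); congr (Some (P + _)%VS); apply: uniq_x.
rewrite /= in PL QL.
split; first by move: Ll; rewrite mem_bb_line => /and3P[].
by rewrite capvS // subv_add PL.
Qed.

Lemma bb_join p q : p \in point_set plane -> q \in point_set plane -> p != q ->
  exists! l, [/\ l \in line_set plane, incident plane p l & incident plane q l].
Proof.
rewrite ![_ \in point_set _]inE => /orP[pa|Sp] /orP[qa|Sq] pq.
- exact: bb_join_affine.
- exact: bb_join_affine_spread.
- have [l [[Ll ql pl] uniq_l]] := bb_join_affine_spread qa Sp.
  by exists l; split=> // k [? ? ?]; apply: uniq_l.
- exact: bb_join_spread.
Qed.

(** Affine lines with the same trace on [Sigma] meet in it. Otherwise the traces span [Sigma], so
    [L + L'] is everything and [L :&: L'] has dimension 2(2m + 1) - (4m + 1) = 1. *)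
Lemma bb_meet l l' : l \in line_set plane -> l' \in line_set plane -> l != l' ->
  exists! p, [/\ p \in point_set plane, incident plane p l & incident plane p l'].
Proof.
move=> Ll Ll' ll'.
(* Two common points would make the lines equal, so existence suffices. *)
suff [p [Pp pl pl']] : exists p, [/\ p \in point_set plane, incident plane p l
    & incident plane p l'].
  exists p; split=> // p' [Pp' p'l p'l'].
  exact: (incident_uniq bb_join Pp Pp' Ll Ll').
have SpreadPoint x : x \in S -> x \in point_set plane.
  by move=> Sx; rewrite inE Sx orbT.
case: l l' Ll Ll' ll' => [L|] [L'|] // Ll Ll' ll'.
- have := Ll; rewrite mem_bb_line => /and3P[/eqP dL LS SL].
  have := Ll'; rewrite mem_bb_line => /and3P[/eqP dL' LS' SL'].
  have [LL'|LL'] := eqVneq (L :&: Sigma)%VS (L' :&: Sigma)%VS.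
    exists (L :&: Sigma)%VS; split; rewrite /= ?capvSl ?SpreadPoint //.
    by rewrite LL' capvSl.
  have SLL' : (L :&: Sigma + L' :&: Sigma = Sigma)%VS.
    apply/eqP; rewrite eqEdim subv_add !capvSr dimv_disjoint_sum.
      by rewrite dimSigma (bb_dim_spread SL) (bb_dim_spread SL'); lia.
    by rewrite (spread_cap0 spreadS SL SL' LL').
  have fullLL' : \dim (L + L')%VS = (4 * m).+1.
    rewrite -dimW (_ : (L + L')%VS = fullv) //; apply/eqP; rewrite eqEdim subvf dimW.
    have : (Sigma <= L + L')%VS by rewrite -[X in (X <= _)%VS]SLL' addvS ?capvSl.
    move/dimv_leqif_sup; rewrite subv_add (negPf LS) dimSigma => -[]; lia.
  exists (L :&: L')%VS; split; rewrite /= ?capvSl ?capvSr //.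
  rewrite inE; apply/orP; left; apply/affineP; split.
    have := dimv_sum_cap L L'; lia.
  (* Inside [Sigma] the intersection would lie in two distinct spread elements and vanish. *)
  apply/negP=> LL'S; have := dimv_sum_cap L L'.
  have -> : (L :&: L' = 0)%VS.
    apply/eqP; rewrite -subv0 -(spread_cap0 spreadS SL SL' LL').
    by rewrite !subv_cap capvSl capvSr LL'S.
  by rewrite dimv0; lia.
- have := Ll; rewrite mem_bb_line => /and3P[_ _ SL].
  by exists (L :&: Sigma)%VS; split; rewrite /= ?capvSl ?SpreadPoint.
- have := Ll'; rewrite mem_bb_line => /and3P[_ _ SL].
  by exists (L' :&: Sigma)%VS; split; rewrite /= ?capvSl ?SpreadPoint.
Qed.

Lemma expn_card_gt1 k : 0 < k -> 1 < #|F| ^ k.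
Proof. by case: k => // k _; rewrite -(expn0 #|F|) ltn_exp2l ?finNzRing_gt1. Qed.

(** With q = [#|F|], this is the factorisation q^(4m) - 1 = (q^(2m) - 1)(q^(2m) + 1). *)
Lemma bb_card_spread : #|S| = (#|F| ^ (2 * m)).+1.
Proof.
have := card_spread spreadS; rewrite dimSigma.
have -> : (2 * m - 1).+1 = 2 * m by lia.
have -> : 4 * m = 2 * m + 2 * m by lia.
rewrite expnD; have := @expn_card_gt1 (2 * m); nia.
Qed.

Lemma bb_card_line l : l \in line_set plane ->
  #|points_on plane l| = (#|F| ^ (2 * m)).+1.
Proof.
case: l => [L|] Ll.
  have := Ll; rewrite mem_bb_line => /and3P[/eqP dL LS SL].
  have -> : points_on plane (Some L) = (L :&: Sigma)%VS |: affine_points L Sigma.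
    apply/setP=> p; rewrite [LHS]inE [p \in point_set _]inE in_setU1.
    apply/andP/orP => [[/orP[/affineP[dp pS]|Sp] pL] | [/eqP-> | ]].
    - by right; apply/affine_pointsP.
    - by left; rewrite (spread_on_bb_line Ll Sp pL).
    - by rewrite SL orbT /= capvSl.
    - by case/affine_pointsP=> dp pL pS; split=> //; apply/orP; left; apply/affineP.
  have LSa : (L :&: Sigma)%VS \notin affine_points L Sigma.
    by apply/negP => /affine_pointsP[_ _]; rewrite capvSr.
  by rewrite cardsU1 LSa (card_affine_points (dim_cap_hyperplane LS)) (bb_dim_spread SL).
rewrite -bb_card_spread; apply: eq_card => x; rewrite !inE /=.
by have [Sx|] := boolP (x \in S); rewrite ?orbT ?andbF.
Qed.

Theorem bb_projective_plane : is_projective_plane plane (#|F| ^ (2 * m)).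
Proof.
split; [exact: bb_join | exact: bb_meet | | exact: bb_card_line].
apply: exists_quadrangle bb_join _ _ => [l Ll|].
  by rewrite bb_card_line // ltnS expn_card_gt1 //; lia.
have /card_gt0P[x Sx] : 0 < #|S| by rewrite bb_card_spread.
have /card_gt0P[P Pa] : 0 < #|affine_points fullv Sigma|.
  rewrite card_affine_points ?expn_gt0 ?(ltnW (finNzRing_gt1 _)) //.
  by rewrite capfv dimW dimSigma.
exists None, (Some (P + x)%VS), x; split=> //; first by rewrite !inE.
- exact: join_bb_line.
- by rewrite !inE Sx orbT.
- by rewrite !inE Sx orbT /= addvSr.
Qed.

(** * The cone with vertex [Vz] over the base [B] *)

Section Cone.
(** [G] stands for the embedded 3m-dimensional subspace, so [G :&: Sigma] is the image of the
    tangent space at infinity. [tangentB] is the form in which minimality of the blocking set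
    enters. *)
Variables (B : {set {vspace W}}) (G z Vz : {vspace W}).
Hypotheses (dimG : \dim G = (3 * m).+1) (Sz : z \in S) (dimVz : \dim Vz = m).
Hypotheses (Vz_sub : (Vz <= z)%VS) (VzA : (Vz :&: (G :&: Sigma) = 0)%VS).
Hypotheses (BG : B \subset affine_points G Sigma) (cardB : #|B| = #|F| ^ (2 * m)).
Hypothesis (tangentB : forall P, P \in B -> exists X,
  [/\ (X <= G)%VS, (P <= X)%VS,
      exists2 Y, Y \in spread_traces S z Vz (G :&: Sigma)%VS & (Y <= X)%VS &
      forall Q, Q \in B -> (Q <= X)%VS -> Q = P]).

Lemma base_affine P : P \in B -> P \in affine_points fullv Sigma.
Proof. by move/(subsetP BG)/affine_pointsP=> [dP _ PS]; apply/affineP. Qed.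

Lemma base_sub P : P \in B -> (P <= G)%VS.
Proof. by move/(subsetP BG)/affine_pointsP=> []. Qed.

Lemma vertex_sub_Sigma : (Vz <= Sigma)%VS.
Proof. exact: subv_trans Vz_sub (spread_sub spreadS Sz). Qed.

(** By the modular law, since [Vz] lies in [Sigma] and hence misses [G]. Thus a subspace of [G] can
    be recovered from its span with [Vz]. *)
Lemma cone_cap_base U : (U <= G)%VS -> ((U + Vz) :&: G = U)%VS.
Proof.
move=> UG; rewrite -vspace_modl // (_ : (Vz :&: G = 0)%VS) ?addv0 //.
by rewrite -(capv_idPl vertex_sub_Sigma) -capvA [(Sigma :&: G)%VS]capvC.
Qed.

(** The two summands are disjoint, of dimensions 3m and m; a point of [B] witnesses that [G] is not
    inside [Sigma]. *)
Lemma vertex_complement : ((G :&: Sigma) + Vz = Sigma)%VS.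
Proof.
have [P BP] : exists P, P \in B.
  by apply/card_gt0P; rewrite cardB expn_gt0 ltnW ?finNzRing_gt1.
have GS : ~~ (G <= Sigma)%VS.
  have /affineP[_] := base_affine BP.
  by apply: contra; apply: subv_trans (base_sub BP).
apply/eqP; rewrite eqEdim subv_add capvSr vertex_sub_Sigma dimv_disjoint_sum ?dimVz.
  by have := dim_cap_hyperplane GS; rewrite dimG dimSigma; lia.
by rewrite capvC.
Qed.

Lemma cone_generator_eq P Q : P \in B -> Q \in affine_points (P + Vz) Sigma ->
  (Q + Vz = P + Vz)%VS.
Proof.
move=> BP /affine_pointsP[dQ QPV QS]; have /affineP[dP PS] := base_affine BP.
have capVz R : \dim R = 1 -> ~~ (R <= Sigma)%VS -> (R :&: Vz = 0)%VS.
  move=> dR RS; apply: cap_dim1 => //; apply: contra RS => /subv_trans; apply.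
  exact: vertex_sub_Sigma.
apply/eqP; rewrite eqEdim subv_add QPV addvSr /=.
by rewrite (dimv_disjoint_sum (capVz _ dQ QS)) (dimv_disjoint_sum (capVz _ dP PS)) dQ dP.
Qed.

(** The base point of a generator is recovered as the intersection of [Q + Vz] with [G]. *)
Lemma cone_base_uniq P P' Q : P \in B -> P' \in B ->
    Q \in affine_points (P + Vz) Sigma -> Q \in affine_points (P' + Vz) Sigma ->
  P = P'.
Proof.
move=> BP BP' /(cone_generator_eq BP) QP /(cone_generator_eq BP') QP'.
by rewrite -(cone_cap_base (base_sub BP)) -(cone_cap_base (base_sub BP')) -QP QP'.
Qed.

Lemma cone_affine P Q : Q \in affine_points (P + Vz) Sigma ->
  Q \in affine_points fullv Sigma.
Proof. by case/affine_pointsP=> dQ _ QS; apply/affineP. Qed.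

Lemma cone_setP Q : reflect
  (Q = z \/ exists2 P, P \in B & Q \in affine_points (P + Vz) Sigma)
  (Q \in cone_set Sigma B z Vz).
Proof.
rewrite in_setU1; apply: (iffP orP) => [[/eqP|/bigcupP[P BP QP]]|[/eqP|[P BP QP]]].
- by left.
- by right; exists P.
- by left.
- by right; apply/bigcupP; exists P.
Qed.

Lemma card_cone_set : #|cone_set Sigma B z Vz| = ((#|F| ^ m) ^ 3).+1.
Proof.
rewrite cardsU1 (_ : z \notin _); last first.
  apply/negP=> /bigcupP[P _ /cone_affine/affine_notin_spread].
  by rewrite Sz.
set C := \bigcup_(P in B) _; rewrite add1n; congr _.+1.
(* Each generator has q^m affine points, and each affine point of the cone lies on exactly one
   generator. *)
have := double_count B C (fun P Q => Q \in affine_points (P + Vz) Sigma).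
rewrite (eq_bigr (fun=> #|F| ^ m)) => [|P BP]; last first.
  have PV : ((P + Vz) :&: Sigma = Vz)%VS.
    exact: join_cap_Sigma (base_affine BP) vertex_sub_Sigma.
  rewrite -dimVz -[in RHS]PV -card_affine_points; last first.
    exact: dim_cap_hyperplane (join_notin_Sigma _ (base_affine BP)).
  apply: eq_card => Q; rewrite inE andb_idl // => QP.
  by apply/bigcupP; exists P.
rewrite [RHS](eq_bigr (fun=> 1)) => [|Q /bigcupP[P BP QP]]; last first.
  rewrite card_unique //; exists P; split=> [|P' /andP[BP' QP']]; first exact/andP.
  exact: cone_base_uniq BP BP' QP QP'.
rewrite sum1_card sum_nat_const cardB => <-.
by rewrite -expnM -expnD; congr (_ ^ _); lia.
Qed.

Lemma cone_tangent_at_vertex :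
  cone_set Sigma B z Vz :&: points_on plane None = [set z].
Proof.
apply/setP=> x; rewrite in_setI in_set1 [x \in points_on _ _]inE.
rewrite [x \in point_set _]inE /=.
apply/andP/eqP => [[/cone_setP[//|[P BP /cone_affine/affine_notin_spread]]] | ->].
  by move/negPf->; rewrite andbF.
by rewrite Sz orbT; split=> //; apply/cone_setP; left.
Qed.

(* Projected from Vz to G, the line joining Q to x falls into the tangent
   subspace X, so it meets no generator of the cone but that of Q. *)
Lemma cone_tangent_at_affine P Q : P \in B -> Q \in affine_points (P + Vz) Sigma ->
  exists2 l, l \in line_set plane & cone_set Sigma B z Vz :&: points_on plane l = [set Q].
Proof.
move=> BP QP; have [X [XG PX [_ /imsetP[x /setD1P[xz Sx] ->] YX] uniqP]] := tangentB BP.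
have Qa := cone_affine QP; have [xS SVz] := (spread_sub spreadS Sx, vertex_sub_Sigma).
(* As [G :&: Sigma] and [Vz] span [Sigma], the trace of [x + Vz] together with [Vz] gives back
   [x + Vz], and [X] contains that trace. *)
have xX : (x + Vz <= X + Vz)%VS.
  have <- : (((x + Vz) :&: (G :&: Sigma)) + Vz = x + Vz)%VS.
    rewrite vspace_modr ?addvSr // vertex_complement; apply/capv_idPl.
    by rewrite subv_add xS.
  by rewrite addvS.
have LX : (Q + x <= X + Vz)%VS.
  rewrite subv_add (subv_trans (addvSl x Vz)) // andbT.
  rewrite (subv_trans (addvSl Q Vz)) // (cone_generator_eq BP QP).
  by rewrite addvS.
exists (Some (Q + x)%VS); first exact: join_bb_line.
apply/setP=> R; rewrite in_setI in_set1; apply/andP/eqP => [[CR LR] | ->]; last first.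
  split; first by apply/cone_setP; right; exists P.
  by rewrite !inE /= addvSl andbT; apply/orP; left; move: Qa; rewrite !inE.
have {LR} RL : (R <= Q + x)%VS by move: LR; rewrite inE => /andP[].
(* The only spread element on the line is [x], which differs from [z]; so [R] is affine. *)
case/cone_setP: CR => [Rz | [P' BP' RP']].
  case/eqP: xz; rewrite -(join_cap_Sigma Qa xS); apply/esym.
  by apply: spread_on_bb_line; rewrite ?join_bb_line // -Rz.
(* [P'] lies in [R + Vz], hence in [X + Vz], whose intersection with [G] is [X]; there [P] is the
   only base point. *)
have P'P : P' = P.
  apply: uniqP => //; rewrite -(cone_cap_base XG) subv_cap (base_sub BP') andbT.
  rewrite (subv_trans (addvSl P' Vz)) // -(cone_generator_eq BP' RP') subv_add addvSr.
  by rewrite (subv_trans RL).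
have Ra := cone_affine RP'; rewrite {}P'P in RP'.
have [[dQ QS] [dR RS]] := (affineP _ Qa, affineP _ Ra).
(* [U] contains both [Q] and [R], while its trace on [Sigma] lies in [Vz] and in [x], hence in
   [z :&: x], which is 0. So [U] is a single point. *)
pose U := ((P + Vz) :&: (Q + x))%VS.
have QU : (Q <= U)%VS.
  by rewrite subv_cap addvSl andbT; case/affine_pointsP: QP.
have RU : (R <= U)%VS.
  by rewrite subv_cap RL andbT; case/affine_pointsP: RP'.
have dU : \dim U = 1.
  have US : ~~ (U <= Sigma)%VS by apply: contra QS; apply: subv_trans.
  rewrite (dim_cap_hyperplane US) (_ : (U :&: Sigma = 0)%VS) ?dimv0 //.
  apply/eqP; rewrite -subv0 -(spread_cap0 spreadS Sx Sz xz) subv_cap.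
  rewrite -[X in (_ <= X)%VS && _](join_cap_Sigma Qa xS) capvS ?capvSr //=.
  rewrite (subv_trans _ Vz_sub) // -(join_cap_Sigma (base_affine BP) SVz) capvS //.
  exact: capvSl.
have /eqP QE : Q == U by rewrite eqEdim QU dU dQ.
have /eqP RE : R == U by rewrite eqEdim RU dU dR.
by rewrite RE -QE.
Qed.

Lemma cone_set_unital : is_unital plane (#|F| ^ m) (cone_set Sigma B z Vz).
Proof.
apply: unital_of_tangents.
- by rewrite -expnM mulnC; apply: bb_projective_plane.
- apply/subsetP=> Q /cone_setP[-> | [P _ /cone_affine Qa]]; rewrite inE.
    by rewrite Sz orbT.
  by rewrite Qa.
- exact: card_cone_set.
move=> Q /cone_setP[-> | [P BP QP]]; last exact: cone_tangent_at_affine BP QP.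
by exists None; [rewrite !inE | apply: cone_tangent_at_vertex].
Qed.

End Cone.

End BruckBose.

(** * Transfer of the egg configuration along the embedding *)

Section InjectiveOnSubspace.
Variables (F : finFieldType) (V W : vectType F) (f : 'Hom(V, W)) (G : {vspace V}).
Hypothesis f_inj : {in G &, injective f}.
Implicit Types U X : {vspace V}.

Lemma dim_limg_in U : (U <= G)%VS -> \dim (f @: U) = \dim U.
Proof.
move=> UG; apply: limg_dim_eq; apply/eqP; rewrite -subv0.
apply/subvP=> u /memv_capP[Uu]; rewrite memv_ker memv0 => /eqP fu0.
by apply/eqP/f_inj; rewrite ?mem0v ?(subvP UG) // fu0 GRing.linear0.
Qed.

(** If the image of [U] lies in that of [X], then [X] and [U + X] have the same image, hence the
    same dimension. *)
Lemma limg_subv_in U X : (U <= G)%VS -> (X <= G)%VS ->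
  (f @: U <= f @: X)%VS = (U <= X)%VS.
Proof.
move=> UG XG; apply/idP/idP=> [fUX | /limgS//].
have UXG : (U + X <= G)%VS by rewrite subv_add UG.
have /eqP -> : X == (U + X)%VS; last exact: addvSl.
rewrite eqEdim addvSr -(dim_limg_in XG) -(dim_limg_in UXG) limgD.
by rewrite dimvS // subv_add fUX subvv.
Qed.

Lemma limg_inj_in U X : (U <= G)%VS -> (X <= G)%VS ->
  (f @: U)%VS = (f @: X)%VS -> U = X.
Proof.
move=> UG XG fUX; apply/eqP.
by rewrite eqEsubv -(limg_subv_in UG XG) -(limg_subv_in XG UG) fUX subvv.
Qed.

End InjectiveOnSubspace.

(** Distinct egg elements are disjoint, so nonzero intersections with [G] are distinct: there are as
    many as egg elements other than [Einf]. *)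
Lemma card_egg_points (F : finFieldType) (V : vectType F) (m : nat)
    (Egg : {set {vspace V}}) (Einf G : {vspace V}) :
    is_egg m Egg -> Einf \in Egg ->
    (forall P, P \in egg_points Egg Einf G -> P != 0%VS) ->
  #|egg_points Egg Einf G| = #|F| ^ (2 * m).
Proof.
case=> cEgg _ disjE _ _ EggEinf nzP.
rewrite card_in_imset => [|E E' EE EE' capE].
  by have := cardsD1 Einf Egg; rewrite cEgg EggEinf => -[->].
apply: contraTeq isT => /(disjE E E').
move: (EE) (EE') => /setD1P[_ EggE] /setD1P[_ EggE'] /(_ EggE EggE') EE'0.
have := nzP _ (imset_f _ EE); rewrite -subv0 => /negP[].
by rewrite -EE'0 subv_cap capvSl capE capvSl.
Qed.

Theorem theorem3 (F : finFieldType) (m : nat) (hm : (1 <= m)%N)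
  (V : vectType F) (hV : \dim {:V} = (4 * m)%N)
  (Egg : {set {vspace V}}) (hEgg : is_egg m Egg)
  (Einf : {vspace V}) (hEinf : Einf \in Egg)
  (Gamma : {vspace V}) (hGamma : \dim Gamma = (3 * m).+1)
  (hEinfGamma : (tangent m Egg Einf <= Gamma)%VS)
  (hmin : minimal_blocking_set Gamma (tangent m Egg Einf)
            (egg_family m Egg Einf Gamma) (egg_points Egg Einf Gamma))
  (W : vectType F) (hW : \dim {:W} = (4 * m).+1)
  (Sigma : {vspace W}) (hSigma : \dim Sigma = (4 * m)%N)
  (* the embedding of Gamma is the restriction of phi to Gamma *)
  (phi : 'Hom(V, W)) (hphi : {in Gamma &, injective phi})
  (hphiSigma : (phi @: Gamma :&: Sigma)%VS = (phi @: tangent m Egg Einf)%VS)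
  (S : {set {vspace W}}) (hS : is_spread (2 * m - 1) Sigma S)
  (z : {vspace W}) (hz : z \in S)
  (Vz : {vspace W}) (hdimVz : \dim Vz = m) (hVz : (Vz <= z)%VS)
  (hVzE : (Vz :&: phi @: tangent m Egg Einf)%VS = 0%VS)
  (hI : [set (phi @: X)%VS | X in egg_traces m Egg Einf] =
        spread_traces S z Vz (phi @: tangent m Egg Einf)%VS) :
  is_unital (bruck_bose_plane m Sigma S) (#|F| ^ m)
    (cone_set Sigma [set (phi @: P)%VS | P in egg_points Egg Einf Gamma] z Vz).
Proof.
case: hmin => points_affine _ points_tangent.
have pointP P : P \in egg_points Egg Einf Gamma ->
    [/\ \dim P = 1, (P <= Gamma)%VS & ~~ (P <= tangent m Egg Einf)%VS].
  by move/(subsetP points_affine)/affine_pointsP.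
apply: (@cone_set_unital _ _ _ _ _ hm hW hSigma hS _ (phi @: Gamma)%VS) => //.
- by rewrite (dim_limg_in hphi).
- by rewrite hphiSigma.
- apply/subsetP=> _ /imsetP[P /pointP[dP PG PT] ->].
  apply/affine_pointsP; split; rewrite ?(dim_limg_in hphi) ?limgS //.
  (* A base point mapped into [Sigma] would map into the image of the tangent space, hence lie in
     that space by injectivity. *)
  apply: contra PT => PS; rewrite -(limg_subv_in hphi PG hEinfGamma) -hphiSigma.
  by rewrite subv_cap limgS.
- rewrite card_in_imset => [|P Q /pointP[_ PG _] /pointP[_ QG _]].
    apply: card_egg_points hEgg hEinf _ => P /pointP[dP _ _].
    by rewrite -dimv_eq0 dP.
  by move/(limg_inj_in hphi PG QG).
move=> _ /imsetP[P EP ->]; have [X [FX PX uniqP]] := points_tangent P EP.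
move: FX; rewrite inE => /and4P[_ XG _ /exists_inP[Y TY YX]].
(* The image of [X] contains the image of the egg trace [Y], which [hI] turns into a spread
   trace. *)
exists (phi @: X)%VS; split; rewrite ?limgS //.
  by exists (phi @: Y)%VS; rewrite ?limgS // hphiSigma -hI imset_f.
move=> _ /imsetP[Q EQ ->] QX; congr (phi @: _)%VS; apply: uniqP => //.
by have [_ QG _] := pointP Q EQ; rewrite -(limg_subv_in hphi QG XG).
Qed.
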